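(* There is an absolute constant $C>0$ such that for every even positive integer $n$ and every $i\in[n]=\{1,\dots,n\}$, the bijection $\psi\colon\{0,1\}^n\to\mathcal{B}_n$ defined in the context satisfies \[ \Pr_{x}[\psi_i(x)=x_i]>1-\frac{C}{\sqrt n}, \] where $x$ is uniformly distributed on $\{0,1\}^n$ and $\psi_i(x)$ denotes the $i$-th bit of $\psi(x)$.
   Context: $|x|$ denotes the Hamming weight of a binary string $x$, $\circ$ denotes concatenation, and $\mathcal{B}_n=\{x\in\{0,1\}^{n+1}: |x|>n/2\}$. Marking stage. Given $x\in\{0,1\}^n$, all coordinates start unmarked. Repeatedly choose two unmarked coordinates $p<q$ with no unmarked coordinate strictly between them and with $x_p=1$, $x_q=0$, and mark both; stop when no such pair exists. The final set of marked coordinates does not depend on the choices made. When the process stops, the unmarked bits, read from left to right, form a string $0\cdots01\cdots1$. Chains. Let $i_1<\dots<i_m$ be the finally unmarked coordinates of $x$ (so $m\equiv n \pmod 2$), and let $k=(n-m)/2$. The chain containing $x$ is $\{c_k,c_{k+1},\dots,c_{n-k}\}$, where $c_r$ (for $k\le r\le n-k$) agrees with $x$ on all marked coordinates, equals $0$ on the $m-(r-k)$ leftmost unmarked coordinates and equals $1$ on the remaining $r-k$ unmarked coordinates. Then $|c_r|=r$. These chains (the De Bruijn–Tengbergen–Kruyswijk chains) partition $\{0,1\}^n$. The map $\psi$. For even $n$ and $x\in\{0,1\}^n$ lying in the chain $\{c_k,\dots,c_{n-k}\}$ with $x=c_j$, \[ \psi(x)=\begin{cases} c_{\frac{(n-k)+j}{2}}\circ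 1, & j\equiv n-k \pmod 2,\\[2pt] c_{\frac{(n-k)+j+1}{2}}\circ 0, & j\not\equiv n-k \pmod 2.\end{cases} \] This is a bijection from $\{0,1\}^n$ to $\mathcal{B}_n$. *)

(* Defs.v *)
From HB Require Import structures.
From mathcomp Require Import all_boot all_order all_algebra.
From mathcomp Require Import reals.
From mathcomp Require Import zify.

Set Implicit Arguments.
Unset Strict Implicit.
Unset Printing Implicit Defensive.

Import Order.TTheory GRing.Theory Num.Theory.

(* {0,1}^n is [n.-tuple bool]; coordinates are numbered from 0. *)

Definition hweight (n : nat) (x : n.-tuple bool) : nat :=
  #|[set i : 'I_n | tnth x i]|.

Section Chains.
Variables (n : nat) (x : n.-tuple bool).

Definition markable (M : {set 'I_n}) (p q : 'I_n) : bool :=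
  [&& p < q, p \notin M, q \notin M,
      [forall r : 'I_n, (p < r < q) ==> (r \in M)],
      tnth x p & ~~ tnth x q].

(* The outcome of the marking process does not depend on the pair chosen at
   each step (lemma [marked_unique]), so the choice is left to [pick]. *)
Definition mark_step (M : {set 'I_n}) : {set 'I_n} :=
  if [pick pq : 'I_n * 'I_n | markable M pq.1 pq.2] is Some pq
  then pq.1 |: (pq.2 |: M) else M.

(* [n] steps are enough for the process to stop: see [marked_stuck]. *)
Definition marked : {set 'I_n} := iter n mark_step set0.

Definition unmarked : {set 'I_n} := ~: marked.

Definition chain_bot : nat := (n - #|unmarked|)./2.

(* The element c_r of the chain of [x], for k <= r <= n - k, where
   k = chain_bot and m = #|unmarked| (junk value for other r): an unmarked
   coordinate is 0 iff it has fewer than m - (r - k) unmarked coordinates on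
   its left. *)
Definition chain_elt (r : nat) : n.-tuple bool :=
  [tuple if i \in marked then tnth x i
         else #|unmarked| - (r - chain_bot) <= #|[set u in unmarked | u < i]|
  | i < n].

(* As |c_r| = r, the index j such that x = c_j is the weight of [x]: see
   [chain_elt_hweight]. *)
Definition psi : n.+1.-tuple bool :=
  let j := hweight x in
  let top := n - chain_bot in
  if j == top %[mod 2]
  then [tuple of rcons (chain_elt (top + j)./2) true]
  else [tuple of rcons (chain_elt (top + j).+1./2) false].

End Chains.

Section ChainTheory.
Variable n : nat.
Implicit Types (x y : n.-tuple bool) (M N : {set 'I_n}).

Inductive reach x M : {set 'I_n} -> Prop :=
| reach0 : reach x M M
| reachS N p q : markable x M p q -> reach x (p |: (q |: M)) N -> reach x M N.

Definition stuck x M : Prop := forall p q, ~~ markable x M p q.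

Lemma markable_eq x M p q p' q' : markable x M p q -> markable x M p' q' ->
  (p, q) != (p', q') -> [/\ p != p', p != q', q != p' & q != q'].
Proof.
move=> /and5P[pq pM qM /forallP bt /andP[xp xq]].
move=> /and5P[pq' pM' qM' /forallP bt' /andP[xp' xq']] ne.
have d u v : tnth x u -> ~~ tnth x v -> u != v.
  by move=> xu; apply: contraNneq => <-.
split; [|exact: d|by rewrite eq_sym; apply: d|].
- apply: contra ne => /eqP e; subst p'; rewrite xpair_eqE eqxx /=.
  case: (ltngtP q q') => h; last by apply/eqP/val_inj.
    by have := bt' q; rewrite pq h /= (negbTE qM).
  by have := bt q'; rewrite pq' h /= (negbTE qM').
- apply: contra ne => /eqP e; subst q'; rewrite xpair_eqE eqxx andbT.
  case: (ltngtP p p') => h; last by apply/eqP/val_inj.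
    by have := bt p'; rewrite pq' h /= (negbTE pM').
  by have := bt' p; rewrite pq h /= (negbTE pM).
Qed.

Lemma markable_keep x M p q p' q' : markable x M p q -> markable x M p' q' ->
  (p, q) != (p', q') -> markable x (p |: (q |: M)) p' q'.
Proof.
move=> m m' ne; have [n1 n2 n3 n4] := markable_eq m m' ne.
case/and5P: m' => pq' pM' qM' /forallP bt' xpq'; apply/and5P; split=> //.
- by rewrite !inE !negb_or eq_sym n1 eq_sym n3.
- by rewrite !inE !negb_or eq_sym n2 eq_sym n4.
- by apply/forallP=> r; apply/implyP=> /(implyP (bt' r)) h; rewrite !inE h !orbT.
Qed.

Lemma reach_step x M N p q : reach x M N -> stuck x N -> markable x M p q ->
  reach x (p |: (q |: M)) N.
Proof.
move=> r st; elim: r p q st => {M N} [M p q /(_ p q)/negP //|].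
move=> M N p q m r IH p' q' st m'.
case: (eqVneq (p, q) (p', q')) => [[<- <-] //|ne].
have m2 : markable x (p |: (q |: M)) p' q' by apply: markable_keep m m' ne.
have m1 : markable x (p' |: (q' |: M)) p q.
  by apply: markable_keep m' m _; rewrite eq_sym.
apply: reachS m1 _.
suff -> : p |: (q |: (p' |: (q' |: M))) = p' |: (q' |: (p |: (q |: M))).
  exact: IH.
by apply/setP=> u; rewrite !inE; do !case: (u == _) => //=.
Qed.

Lemma reach_confluent x M N N' : reach x M N -> stuck x N ->
  reach x M N' -> stuck x N' -> N = N'.
Proof.
move=> r st r'; elim: r' r => {M N'} [M r st'|M N' p q m r' IH r st'].
  by case: r st' => // N0 p q m _ /(_ p q)/negP.
by apply: IH => //; apply: reach_step.
Qed.

Lemma mark_stepP x M :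
  (exists p q, markable x M p q /\ mark_step x M = p |: (q |: M)) \/
  (stuck x M /\ mark_step x M = M).
Proof.
rewrite /mark_step; case: pickP => [[p q] /= m|h]; first by left; exists p, q.
by right; split=> // p q; apply/negbT/(h (p, q)).
Qed.

Lemma reach_iter x k M : reach x M (iter k (mark_step x) M).
Proof.
elim: k M => [|k IH] M; first exact: reach0.
rewrite iterSr; case: (mark_stepP x M) => [[p [q [m ->]]]|[_ ->]] //.
exact: reachS m _.
Qed.

Lemma card_mark x M p q : markable x M p q -> #|p |: (q |: M)| = #|M|.+2.
Proof.
case/and5P=> pq pM qM _ _; rewrite !cardsU1 !inE negb_or pM qM andbT.
by rewrite neq_ltn pq.
Qed.

Lemma marked_reach x : reach x set0 (marked x).
Proof. exact: reach_iter. Qed.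

Lemma marked_stuck x : stuck x (marked x).
Proof.
have h k : stuck x (iter k (mark_step x) set0) \/
    k.*2 <= #|iter k (mark_step x) set0|.
  elim: k => [|k IH]; first by right.
  rewrite iterS; set M := iter k _ _ in IH *.
  case: (mark_stepP x M) => [[p [q [m ->]]]|[st ->]]; last by left.
  case: IH => [/(_ p q)/negP //|le]; right.
  by rewrite (card_mark m) doubleS !ltnS.
case: (h n) => // le p q; apply/negP => /card_mark e.
have := max_card (mem (p |: (q |: marked x))); rewrite e card_ord => lt.
by have := leq_trans (leq_trans lt _) le; rewrite -addnn leq_addr ltnNge leqnSn => /(_ isT).
Qed.

Lemma marked_unique x M : reach x set0 M -> stuck x M -> M = marked x.
Proof.
move=> r st; apply: (reach_confluent r st); [exact: marked_reach|exact: marked_stuck].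
Qed.

Lemma reach_card x M N : reach x M N -> #|[set i in M | tnth x i]|.*2 = #|M| ->
  #|[set i in N | tnth x i]|.*2 = #|N|.
Proof.
elim=> {M N} // M N p q m _ IH e; apply: IH; rewrite (card_mark m) -e -doubleS.
case/and5P: m => pq pM qM _ /andP[xp xq]; congr _.*2.
rewrite (_ : [set i in _ | _] = p |: [set i in M | tnth x i]).
  by rewrite cardsU1 !inE (negbTE pM).
apply/setP=> i; rewrite !inE; case: (eqVneq i p) => [->|_] /=; first by rewrite xp.
by case: eqVneq => [->|_] //=; rewrite (negbTE xq) andbF.
Qed.

Lemma marked_ones x : #|[set i in marked x | tnth x i]|.*2 = #|marked x|.
Proof.
apply: reach_card (marked_reach x) _; rewrite cards0; apply/eqP.
by rewrite double_eq0 cards_eq0; apply/eqP/setP=> i; rewrite !inE.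
Qed.

Lemma chain_bot_ones x : chain_bot x = #|[set i in marked x | tnth x i]|.
Proof.
rewrite /chain_bot /unmarked; have := cardsC (marked x).
by rewrite card_ord -(marked_ones x) => {1}<-; rewrite addnK doubleK.
Qed.

Lemma card_unmarked x : #|unmarked x| + (chain_bot x).*2 = n.
Proof. by rewrite chain_bot_ones marked_ones addnC cardsC card_ord. Qed.

Lemma chain_topE x : n - chain_bot x = chain_bot x + #|unmarked x|.
Proof.
have := congr1 (subn^~ (chain_bot x)) (card_unmarked x).
by rewrite -addnn addnA addnK addnC => <-.
Qed.

Lemma card_rank_ge (U : {set 'I_n}) t :
  #|[set i in U | t <= #|[set u in U | u < i]|]| = #|U| - t.
Proof.
have [c] := ubnP #|U|; elim: c U t => // c IH U t; rewrite ltnS => cU.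
case: (set_0Vmem U) => [->|[i0 i0U]].
  by rewrite cards0; apply: eq_card0 => i; rewrite !inE.
case: (arg_maxnP (fun i : 'I_n => val i) i0U) => m mU0 mmax0.
have mU : m \in U by [].
have mmax u : u \in U -> u <= m := mmax0 u.
have cV : #|U| = #|U :\ m|.+1 by rewrite (cardsD1 m U) mU.
have rk i : i \in U :\ m ->
   #|[set u in U | u < i]| = #|[set u in U :\ m | u < i]|.
  rewrite 2!inE => /andP[im iU]; congr #|pred_of_set _|; apply/setP=> u.
  rewrite !inE; case: eqVneq => //= ->.
  by rewrite mU /= ltnNge (mmax i iU).
have rkm : #|[set u in U | u < m]| = #|U :\ m|.
  congr #|pred_of_set _|; apply/setP=> u; rewrite !inE.
  case uU: (u \in U); rewrite ?andbF //= andbT.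
  by rewrite ltn_neqAle; rewrite (mmax u uU) andbT.
have e : _ = #|U :\ m| - t := IH (U :\ m) t ltac:(by rewrite -cV).
rewrite (cardsD1 m) inE mU rkm cV /=.
rewrite (_ : _ :\ m = [set i in U :\ m | t <= #|[set u in U :\ m | u < i]|]).
  rewrite e; case: leqP => h; first by rewrite subSn.
  by rewrite (eqP (ltnW h : _ - _ == 0)) (eqP (h : _ - _ == 0)).
apply/setP=> i; rewrite 2!inE [in RHS]inE.
case iV: (i \in U :\ m).
  by rewrite -(rk _ iV); move: iV; rewrite !inE => /andP[-> ->].
by move: iV; rewrite !inE; case: (i == m) => //= ->.
Qed.

Lemma hweight_split x M : hweight x =
  #|[set i in M | tnth x i]| + #|[set i in ~: M | tnth x i]|.
Proof.
rewrite /hweight -(cardsID M [set i | tnth x i]); congr (_ + _); apply: eq_card => i;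
  by rewrite !inE andbC.
Qed.

Lemma hweight_chain_elt x r : chain_bot x <= r <= n - chain_bot x ->
  hweight (chain_elt x r) = r.
Proof.
move=> /andP[kr rn]; rewrite (hweight_split _ (marked x)).
have -> : [set i in marked x | tnth (chain_elt x r) i] =
          [set i in marked x | tnth x i].
  by apply/setP=> i; rewrite !inE tnth_mktuple; case: ifP.
rewrite -chain_bot_ones.
have -> : [set i in ~: marked x | tnth (chain_elt x r) i] =
  [set i in unmarked x | #|unmarked x| - (r - chain_bot x) <=
       #|[set u in unmarked x | u < i]|].
  by apply/setP=> i; rewrite !inE tnth_mktuple; case: ifP.
rewrite card_rank_ge subKn ?subnKC // leq_subLR addnC.
by rewrite addnC -chain_topE.
Qed.

Lemma unmarked_sorted x (i j : 'I_n) : i \in unmarked x -> j \in unmarked x ->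
  i < j -> tnth x i -> tnth x j.
Proof.
have [d] := ubnP (j - i); elim: d i j => // d IH i j; rewrite ltnS => le iU jU ij xi.
apply: contraT => xj; have := marked_stuck x i j.
rewrite /markable ij xi xj /=; move: (iU) (jU); rewrite !inE => -> -> /=.
rewrite andbT negb_forall => /existsP[r]; rewrite negb_imply => /andP[/andP[ir rj] rM].
have rU : r \in unmarked x by rewrite inE.
have xr : tnth x r.
  by apply: (IH i r) => //; apply: leq_trans le; apply: ltn_sub2r => //; apply: ltn_trans rj.
rewrite (IH r j) // in xj; apply: leq_trans le; apply: ltn_sub2l => //.
Qed.

Lemma chain_bot_le_hweight x : chain_bot x <= hweight x <= n - chain_bot x.
Proof.
rewrite (hweight_split x (marked x)) -chain_bot_ones leq_addr /=.
rewrite chain_topE leq_add2l.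
by apply: subset_leq_card; apply/subsetP=> i; rewrite !inE => /andP[].
Qed.

Lemma chain_elt_hweight x : chain_elt x (hweight x) = x.
Proof.
apply: eq_from_tnth => i; rewrite tnth_mktuple; case: ifP => // iM.
have iU : i \in unmarked x by rewrite inE iM.
rewrite (hweight_split x (marked x)) -chain_bot_ones addKn -/(unmarked x).
have -> : #|unmarked x| - #|[set u in unmarked x | tnth x u]| =
          #|[set u in unmarked x | ~~ tnth x u]|.
  rewrite -(cardsID [set u | tnth x u] (unmarked x)).
  rewrite (_ : _ :&: _ = [set u in unmarked x | tnth x u]) ?addKn.
    by congr #|pred_of_set _|; apply/setP=> u; rewrite !inE andbC.
  by apply/setP=> u; rewrite !inE.
case xi: (tnth x i).
  apply: subset_leq_card; apply/subsetP=> u; rewrite [in X in X -> _]inE => /andP[uU xu].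
  rewrite inE uU /= ltnNge; apply: contra xu => iu.
  move: iu; rewrite leq_eqVlt => /orP[/eqP/val_inj <- //|iu].
  exact: unmarked_sorted iU uU iu xi.
apply/negbTE; rewrite -ltnNge; apply: proper_card; apply/properP; split.
  apply/subsetP=> u; rewrite [in X in X -> _]inE => /andP[uU ui]; rewrite inE uU /=.
  by apply/negP => xu; have := unmarked_sorted uU iU ui xu; rewrite xi.
by exists i; rewrite inE iU ?xi ?ltnn.
Qed.

Lemma reach_sub x M N : reach x M N -> M \subset N.
Proof.
elim=> {M N} // M N p q _ _; apply: subset_trans.
by apply/subsetP=> i iM; rewrite !inE iM !orbT.
Qed.

Lemma reach_ext x y M N : reach x M N ->
  {in N, forall i, tnth x i = tnth y i} -> reach y M N.
Proof.
elim=> {M N} [M _|M N p q m r IH e]; first exact: reach0.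
apply: reachS (IH e); move: (m); rewrite /markable !e //.
  by apply: (subsetP (reach_sub r)); rewrite !inE eqxx orbT.
by apply: (subsetP (reach_sub r)); rewrite !inE eqxx.
Qed.

Lemma marked_chain_elt x r : marked (chain_elt x r) = marked x.
Proof.
apply/esym/marked_unique.
  apply: reach_ext (marked_reach x) _ => i iM.
  by rewrite tnth_mktuple iM.
move=> p q; apply/negP => /and5P[pq pM qM _ /andP[]].
rewrite !tnth_mktuple (negbTE pM) (negbTE qM) => h /negP[].
apply: leq_trans h _; apply: subset_leq_card; apply/subsetP=> u.
by rewrite [in X in X -> _]inE => /andP[uU up]; rewrite inE uU /= (ltn_trans up).
Qed.

Lemma chain_elt_eq x y r : marked x = marked y ->
  {in marked x, forall i, tnth x i = tnth y i} -> chain_elt x r = chain_elt y r.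
Proof.
move=> e h; apply: eq_from_tnth => i; rewrite !tnth_mktuple.
rewrite /chain_bot /unmarked -e; case: ifP => // /h //.
Qed.

Lemma chain_elt_idem x r s : chain_elt (chain_elt x r) s = chain_elt x s.
Proof.
apply: chain_elt_eq; first exact: marked_chain_elt.
by move=> i; rewrite marked_chain_elt tnth_mktuple => ->.
Qed.

End ChainTheory.

Definition Bset (n : nat) : {set n.+1.-tuple bool} :=
  [set y : n.+1.-tuple bool | n < (hweight y).*2].

Section PsiTheory.
Variable n : nat.
Implicit Types x y : n.-tuple bool.

Lemma hweight_count m (y : m.-tuple bool) : hweight y = count id y.
Proof.
by rewrite /hweight cardsE -sum1_card -sum1_count [RHS]big_tuple; apply: eq_bigl.
Qed.

Lemma hweight_rcons y b : hweight [tuple of rcons y b] = hweight y + b.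
Proof. by rewrite !hweight_count /= -cats1 count_cat /= addn0. Qed.

Hypothesis n_even : ~~ odd n.

Let psi_idx x : nat := (n - chain_bot x + hweight x).+1./2.
Let psi_bit x : bool := hweight x == n - chain_bot x %[mod 2].

Let psiE x : psi x = [tuple of rcons (chain_elt x (psi_idx x)) (psi_bit x)].
Proof.
rewrite /psi /psi_idx /psi_bit; case: eqP => // h.
congr [tuple of rcons (chain_elt x _) _]; lia.
Qed.

Let psi_arith x : chain_bot x <= psi_idx x <= n - chain_bot x /\
  n < (psi_idx x + psi_bit x).*2.
Proof.
have := card_unmarked x; have /andP := chain_bot_le_hweight x.
by move: n_even; rewrite /psi_idx /psi_bit; case: eqP; lia.
Qed.

Lemma hweight_psi x : n < (hweight (psi x)).*2.
Proof.
by have [h w] := psi_arith x; rewrite psiE hweight_rcons hweight_chain_elt.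
Qed.

Lemma psi_inj : injective (@psi n).
Proof.
move=> x y; rewrite !psiE => /(congr1 val)/= /rcons_inj[ec0 eb].
have ec : chain_elt x (psi_idx x) = chain_elt y (psi_idx y) by apply: val_inj.
have em : marked x = marked y.
  by rewrite -(marked_chain_elt x (psi_idx x)) ec marked_chain_elt.
have ek : chain_bot x = chain_bot y by rewrite /chain_bot /unmarked em.
have ei : psi_idx x = psi_idx y.
  have [hx _] := psi_arith x; have [hy _] := psi_arith y.
  by rewrite -(hweight_chain_elt hx) ec hweight_chain_elt.
have ew : hweight x = hweight y.
  move: ei eb; rewrite /psi_idx /psi_bit ek; do 2 case: eqP => //; lia.
rewrite -(chain_elt_hweight x) -(chain_elt_hweight y) ew.
by rewrite -(chain_elt_idem x (psi_idx x)) ec chain_elt_idem.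
Qed.

Lemma psi_surj (y : n.+1.-tuple bool) : n < (hweight y).*2 ->
  exists x, psi x = y.
Proof.
case/tupleP: y => a s.
have -> : [tuple of a :: s] = [tuple of rcons [tuple of belast a s] (last a s)].
  by apply: val_inj; rewrite /= lastI.
move: [tuple of belast a s] (last a s) => c b; rewrite hweight_rcons => hw.
set k := chain_bot c; set r := hweight c in hw.
pose j := r.*2 - ~~ b - (n - k).
have := card_unmarked c; have /andP := chain_bot_le_hweight c.
rewrite -/k -/r => -[kr rt] nk.
have hj : k <= j <= n - k by move: n_even; rewrite /j; case: (b) hw => /=; lia.
have ek : chain_bot (chain_elt c j) = k.
  by rewrite /chain_bot /unmarked marked_chain_elt.
exists (chain_elt c j); rewrite psiE /psi_idx /psi_bit ek hweight_chain_elt //.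
have -> : (n - k + j).+1./2 = r by move: n_even; rewrite /j; case: (b) hw => /=; lia.
have -> : (j == n - k %[mod 2]) = b.
  by move: n_even; rewrite /j; case: (b) hw => /=; case: eqP; lia.
by rewrite chain_elt_idem chain_elt_hweight.
Qed.

Lemma psi_bij : injective (@psi n) /\ @psi n @: [set: n.-tuple bool] = Bset n.
Proof.
split; first exact: psi_inj.
apply/setP=> y; rewrite inE; apply/imsetP/idP => [[x _ ->]|/psi_surj[x <-]].
  exact: hweight_psi.
by exists x.
Qed.

End PsiTheory.

Definition prob_unif (R : realType) (T : finType) (E : {set T}) : R :=
  (#|E|%:R / #|T|%:R)%R.

(* Main.v *)
(* If psi changes the i-th bit of x, then x_i is an unmarked 0 lying in the right
   half of the unmarked zeros. Reverse and complement the initial segment of x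
   ending at i. Read outwards from i, the marked pairs on either side of i open
   before they close, and the unmarked zeros up to i, which now count as ones, are
   at least as many as those after i; hence no prefix of the new string has more
   zeros than ones. The new string thus has no unmarked zero, i.e. it is the top
   of its chain, and there are as many chains as strings of weight n/2. So at most
   'C(n, n/2) strings x are affected, and this is at most 2^n / sqrt (n + 1). *)

Require Import Defs.
From HB Require Import structures.
From mathcomp Require Import all_boot all_order all_algebra.
From mathcomp Require Import reals.
From mathcomp Require Import zify.

Set Implicit Arguments.
Unset Strict Implicit.
Unset Printing Implicit Defensive.

Import Order.TTheory GRing.Theory Num.Theory.

Section ChangedCoordinate.
Variable n : nat.
Implicit Types (x y : n.-tuple bool) (M N A B : {set 'I_n}) (i j p q : 'I_n).

(** * Marked pairs, and the bits changed by [psi] *)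

Lemma card_setU1I (T : finType) (t : T) (M A : {set T}) : t \notin M ->
  #|(t |: M) :&: A| = (t \in A) + #|M :&: A|.
Proof.
move=> tM; case tA: (t \in A).
  have -> : (t |: M) :&: A = t |: (M :&: A).
    by rewrite setIUl; congr (_ :|: _); apply/setIidPl; rewrite sub1set.
  by rewrite cardsU1 !inE (negbTE tM).
by apply: eq_card => u; rewrite !inE; case: eqP => //= ->; rewrite tA andbF.
Qed.

(* The two coordinates of a pair marked together lie on the same side of a
   finally unmarked [i]. *)
Lemma marked_balance x i A B : i \in unmarked x ->
  (forall p q, p < q -> ~~ (p <= i <= q) -> tnth x p -> ~~ tnth x q ->
    (p \in A) + (q \in A) <= (p \in B) + (q \in B)) ->
  #|marked x :&: A| <= #|marked x :&: B|.
Proof.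
rewrite inE => iN H.
suff gen M N : reach x M N -> i \notin N -> #|M :&: A| <= #|M :&: B| ->
    #|N :&: A| <= #|N :&: B|.
  by apply: gen (marked_reach x) iN _; rewrite !set0I.
elim=> {M N} [//|M N p q m r IH] {}iN le.
have := subsetP (reach_sub r); move: m => /and5P[pq pM qM /forallP bt /andP[xp xq]] sub.
have pqM : p \notin q |: M by rewrite !inE negb_or pM andbT neq_ltn pq.
apply: (IH iN); rewrite !card_setU1I // !addnA; apply: leq_add => //.
(* If [p <= i <= q], then [i] is [p], [q] or a coordinate already marked in between, so it ends up
   in [N]. *)
apply: H => //; apply: contra iN => /andP[pi iq]; apply: sub; rewrite !inE.
case: (eqVneq i p) => //= ip; case: (eqVneq i q) => //= iq'.
by apply: (implyP (bt i)); move: ip iq'; rewrite -!val_eqE /=; lia.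
Qed.

Lemma unmarked_zero_before x i j : i \in unmarked x -> ~~ tnth x i ->
  j \in unmarked x -> j <= i -> ~~ tnth x j.
Proof.
move=> iU xi jU; rewrite leq_eqVlt => /orP[/eqP/val_inj -> //|ji].
by apply: contra xi; apply: unmarked_sorted ji.
Qed.

Definition unmarked_zeros x : {set 'I_n} := [set u in unmarked x | ~~ tnth x u].

Definition unmarked_before x i : {set 'I_n} := [set u in unmarked x | u < i].

Lemma card_unmarked_zeros x : #|unmarked_zeros x| + hweight x = n - chain_bot x.
Proof.
rewrite (hweight_split x (marked x)) -chain_bot_ones chain_topE addnCA.
congr (_ + _); rewrite -(cardsID [set u | tnth x u] (unmarked x)) addnC.
by congr (_ + _); apply: eq_card => u; rewrite !inE // andbC.
Qed.

Lemma tnth_rcons_widen y b i :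
  tnth [tuple of rcons y b] (widen_ord (leqnSn n) i) = tnth y i.
Proof. by rewrite !(tnth_nth false) /= nth_rcons size_tuple ltn_ord. Qed.

(** One index covers both parities: when the sum is even, the extra [.+1] is lost in the halving. *)
Lemma tnth_psi x i :
  tnth (psi x) (widen_ord (leqnSn n) i) =
  tnth (chain_elt x (n - chain_bot x + hweight x).+1./2) i.
Proof.
rewrite /psi; case: eqP => e; rewrite tnth_rcons_widen //.
by congr (tnth (chain_elt x _) _); lia.
Qed.

(* psi turns the right half of the unmarked zeros, rounded up, into ones. *)
Lemma psi_changed x i : tnth (psi x) (widen_ord (leqnSn n) i) != tnth x i ->
  [/\ i \in unmarked x, ~~ tnth x i &
      #|unmarked_zeros x| <= #|unmarked_before x i|.*2.+1].
Proof.
rewrite tnth_psi => ne.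
have iU : i \in unmarked x.
  by rewrite inE; apply: contra ne => iM; rewrite tnth_mktuple iM.
have iM : i \in marked x = false by move: iU; rewrite inE => /negbTE.
have := congr1 (fun y => tnth y i) (chain_elt_hweight x); rewrite tnth_mktuple iM => xi.
have := card_unmarked_zeros x; have := chain_topE x.
have /andP[b1 b2] := chain_bot_le_hweight x => b3 b4.
move: ne; rewrite -xi tnth_mktuple iM.
(* With [z] unmarked zeros, a bit is 1 from rank [z] on in [x] and from rank [z./2] on in [psi x];
   hence no 1 becomes 0. *)
rewrite -/(unmarked_before x i); case: leqP => h1; case: leqP => h2 // _; last by lia.
by split=> //; lia.
Qed.

(** * Reversing and complementing an initial segment *)

Lemma rev_upto_subproof i j : (if j <= i then i - j else j) < n.
Proof. by case: ifP => // _; apply: leq_ltn_trans (leq_subr _ _) (ltn_ord i). Qed.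

Definition rev_upto i j : 'I_n := Ordinal (rev_upto_subproof i j).

Lemma rev_upto_le i j : (rev_upto i j <= i) = (j <= i).
Proof. by rewrite /=; case: ifP => // _; rewrite leq_subr. Qed.

Lemma rev_uptoK i : involutive (rev_upto i).
Proof.
move=> j; apply: val_inj; rewrite /= -/(nat_of_ord (rev_upto i j)) rev_upto_le.
by case: ifP => //= h; rewrite ?h ?subKn.
Qed.

Definition flip_upto i x : n.-tuple bool :=
  [tuple tnth x (rev_upto i j) (+) (j <= i) | j < n].

Lemma flip_uptoK i : involutive (flip_upto i).
Proof.
move=> x; apply: eq_from_tnth => j.
by rewrite !tnth_mktuple rev_upto_le rev_uptoK addbK.
Qed.

Definition balanced y := forall r,
  #|[set j | ~~ tnth y j & j <= r]| <= #|[set j | tnth y j & j <= r]|.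

Lemma flip_upto_balanced x i : tnth (psi x) (widen_ord (leqnSn n) i) != tnth x i ->
  balanced (flip_upto i x).
Proof.
move=> /psi_changed[iU xi few] r.
have card_pre (C : {set 'I_n}) := card_preimset C (inv_inj (rev_uptoK i)).
(* [A] and [B] are the zeros and ones of the prefix, pulled back to coordinates of [x]. *)
rewrite -card_pre -[X in _ <= X]card_pre; set A := _ @^-1: _; set B := _ @^-1: _.
have inA j : (j \in A) = (tnth x j == (j <= i)) && (rev_upto i j <= r).
  rewrite !inE tnth_mktuple rev_upto_le rev_uptoK.
  by case: (tnth x j); case: (j <= i).
have inB j : (j \in B) = (tnth x j != (j <= i)) && (rev_upto i j <= r).
  rewrite !inE tnth_mktuple rev_upto_le rev_uptoK.
  by case: (tnth x j); case: (j <= i).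
have before j : j \in unmarked x -> j <= i -> tnth x j = false.
  by move=> jU ji; apply/negbTE; apply: unmarked_zero_before iU xi jU ji.
rewrite -(cardsID (marked x) A) -(cardsID (marked x) B) ![_ :&: marked x]setIC.
apply: leq_add.
  (* The coordinate that now carries the one is [q] left of [i] and [p] right of [i]; in both cases
     it enters the prefix first. *)
  apply: (marked_balance iU) => p q pq pq_i xp xq; rewrite !inA !inB xp (negbTE xq) /=.
  case: (leqP p i) pq_i => pi; case: (leqP q i) => qi /= pq_i; lia.
pose after := [set u in unmarked_zeros x | i < u].
have card_after : #|after| <= #|unmarked_before x i|.
  have := cardsID [set u : 'I_n | i < u] (unmarked_zeros x).
  rewrite (_ : _ :&: _ = after); last by apply/setP=> u; rewrite !inE.
  (* The summand 1 in [few] accounts for [i] itself. *)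
  rewrite (_ : _ :\: _ = i |: unmarked_before x i).
    by move: few; rewrite cardsU1 !inE ltnn andbF /reverse_coercion; lia.
  apply/setP=> u; rewrite !inE -leqNgt -val_eqE /=.
  case: (ltngtP u i) => [ui|iu|/val_inj ->]; rewrite ?andbF ?andbT ?orbF //=.
    by case uM: (u \in marked x) => //=; rewrite before ?(ltnW ui) // inE uM.
  by rewrite -in_setC iU xi.
(* A prefix within the segment has no zero from an unmarked coordinate; a longer one has such zeros
   only from [after], and ones from all of [unmarked_before x i]. *)
have [ri|ir] := leqP r i.
  rewrite [X in X <= _](_ : _ = 0) //; apply/eqP; rewrite cards_eq0; apply/eqP/setP=> j.
  rewrite in_setD inA in_set0 /=; apply/negP => /and3P[jM /eqP xj].
  case: ifP xj => ji xj; last by lia.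
  by rewrite before ?inE in xj.
apply: (leq_trans _ (leq_trans card_after _)); apply: subset_leq_card; apply/subsetP=> j.
  rewrite in_setD inA => /and3P[jM /eqP xj _]; rewrite !inE jM /=.
  case: (leqP j i) xj => ji; last by move=> ->.
  by rewrite before ?inE.
rewrite in_set => /andP[jU ji]; rewrite in_setD inB before ?(ltnW ji) //=.
by move: jU; rewrite inE => -> /=; rewrite (ltnW ji) (leq_trans (leq_subr _ _) (ltnW ir)).
Qed.

(** In the prefix ending at an unmarked zero, marked pairs cancel and all other bits are zeros, so
    zeros prevail. *)
Lemma balanced_unmarked y : balanced y -> unmarked_zeros y = set0.
Proof.
move=> bal; apply/eqP/set0Pn => -[i]; rewrite in_set => /andP[iU yi].
pose A := [set j | tnth y j & j <= i]; pose B := [set j | ~~ tnth y j & j <= i].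
have := bal i; rewrite -/A -/B leqNgt => /negP; apply.
rewrite -(cardsID (marked y) A) -(cardsID (marked y) B) ![_ :&: marked y]setIC.
rewrite -addnS; apply: leq_add.
  apply: (marked_balance iU) => p q pq pq_i yp yq; rewrite !inE yp (negbTE yq) /=; lia.
rewrite [X in X < _](_ : _ = 0).
  rewrite card_gt0; apply/set0Pn; exists i.
  by move: iU; rewrite !inE yi leqnn => ->.
apply/eqP; rewrite cards_eq0; apply/eqP/setP=> j; rewrite !inE; apply/negP => /and3P[jM yj ji].
by have := unmarked_zero_before iU yi _ ji; rewrite inE jM yj => /(_ isT).
Qed.

(** * Counting the affected strings *)

Lemma card_hweight k : #|[set x : n.-tuple bool | hweight x == k]| <= 'C(n, k).
Proof.
rewrite -[X in 'C(X, _)](card_ord n) -card_draws.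
pose f x := [set i : 'I_n | tnth x i].
have f_inj : injective f.
  by move=> x y /setP e; apply: eq_from_tnth => i; have := e i; rewrite !inE.
rewrite -(card_imset _ f_inj); apply: subset_leq_card; apply/subsetP=> _ /imsetP[x + ->].
by rewrite !inE.
Qed.

(* A string without unmarked zeros is the top of its chain, and the chain meets
   the middle layer. *)
Lemma card_no_unmarked_zeros :
  #|[set y : n.-tuple bool | unmarked_zeros y == set0]| <= 'C(n, n./2).
Proof.
apply: leq_trans (card_hweight _).
have top y : unmarked_zeros y == set0 ->
    chain_elt (chain_elt y n./2) (n - chain_bot (chain_elt y n./2)) = y.
  move=> /eqP y0; rewrite chain_elt_idem /chain_bot /unmarked marked_chain_elt.
  rewrite -/(unmarked y) -/(chain_bot y) -card_unmarked_zeros y0 cards0.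
  exact: chain_elt_hweight.
rewrite -(card_in_imset (f := fun y => chain_elt y n./2)); last first.
  by move=> y z; rewrite !inE => /top {2}<- /top {2}<- ->.
apply: subset_leq_card; apply/subsetP=> _ /imsetP[y _ ->]; rewrite inE.
by rewrite hweight_chain_elt //; have := card_unmarked y; lia.
Qed.

Lemma card_psi_changed i :
  #|[set x | tnth (psi x) (widen_ord (leqnSn n) i) != tnth x i]| <= 'C(n, n./2).
Proof.
apply: leq_trans card_no_unmarked_zeros.
rewrite -(card_imset _ (inv_inj (flip_uptoK i))).
apply: subset_leq_card; apply/subsetP=> _ /imsetP[x + ->]; rewrite !inE.
by move=> /flip_upto_balanced/balanced_unmarked ->.
Qed.

End ChangedCoordinate.

(** By induction: consecutive central binomials have ratio 2(2a+1)/(a+1), and (2a+1)(2a+3) <=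
    4(a+1)^2. *)
Lemma central_binomial_sq a : a.*2.+1 * 'C(a.*2, a) ^ 2 <= 16 ^ a.
Proof.
elim: a => [|a IH]; first by rewrite bin0.
have h : a.+1 * 'C(a.*2.+2, a.+1) = a.*2.+1.*2 * 'C(a.*2, a).
  have h1 := mul_bin_diag a.*2.+2 a; have h2 := mul_bin_down a.*2.+1 a.
  have e : a.*2.+1 - a = a.+1 by lia.
  by rewrite e /= in h2; rewrite -h1 /= -doubleS -[a.+1.*2]muln2 mulnAC -h2 mulnAC muln2.
rewrite doubleS (expnS 16) -(@leq_pmul2l (a.+1 ^ 2)) //.
have -> : a.+1 ^ 2 * (a.*2.+3 * 'C(a.*2.+2, a.+1) ^ 2) =
          (a.*2.+3 * a.*2.+1 * 4) * (a.*2.+1 * 'C(a.*2, a) ^ 2).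
  by rewrite mulnCA -expnMn h; nia.
by rewrite [X in _ <= X]mulnA leq_mul // -mulnn; nia.
Qed.

Local Open Scope ring_scope.

Theorem proposition1p4 (R : realType) :
  exists C : R, 0 < C /\
    forall (n : nat) (i : 'I_n), (0 < n)%N -> ~~ odd n ->
      1 - C / Num.sqrt n%:R <
        prob_unif R [set x : n.-tuple bool |
                      tnth (psi x) (widen_ord (leqnSn n) i) == tnth x i].
Proof.
exists 1; split=> // n i n_gt0 n_even; rewrite /prob_unif.
set E := [set _ | _].
have cE : (#|E| + #|~: E| = 2 ^ n)%N by rewrite cardsC card_tuple card_bool.
have cEc : (#|~: E| <= 'C(n, n./2))%N.
  apply: leq_trans (card_psi_changed i).
  by apply: subset_leq_card; apply/subsetP=> x; rewrite !inE.
have sq : (n * #|~: E| ^ 2 < (2 ^ n) ^ 2)%N.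
  have e : n = n./2.*2 by rewrite even_halfK.
  have := central_binomial_sq n./2; rewrite -e.
  have -> : (16 ^ n./2 = (2 ^ n) ^ 2)%N by rewrite [in RHS]e -expnM -muln2 -mulnA mulnC expnM.
  (* The factor [n.+1] leaves a spare positive square, which makes the bound strict with constant
     1. *)
  apply: leq_trans; rewrite mulSn -addn1 addnC.
  have lt0 : (0 < 'C(n, n./2))%N by rewrite bin_gt0; lia.
  by rewrite leq_add ?expn_gt0 ?lt0 // leq_mul2l leq_exp2r // cEc orbT.
rewrite card_tuple card_bool -cE.
have s_gt0 : 0 < Num.sqrt n%:R :> R by rewrite sqrtr_gt0 ltr0n.
have p_gt0 : 0 < (#|E| + #|~: E|)%:R :> R by rewrite cE ltr0n expn_gt0.
(* Passing to the complement and squaring reduces the claim to [sq]. *)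
rewrite ltrBlDr -ltrBlDl -[X in X - _](divff (lt0r_neq0 p_gt0)) -mulrBl.
rewrite -natrB ?leq_addr // addKn ltr_pdivrMr // mulrAC mul1r ltr_pdivlMr //.
rewrite -ltr_sqr ?nnegrE ?mulr_ge0 ?ler0n ?sqrtr_ge0 //.
by rewrite exprMn sqr_sqrtr ?ler0n // -!natrX -natrM ltr_nat cE mulnC.
Qed.
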